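(* Let $(R,\mathcal{M})$ be a commutative local ring such that every ideal of $R$ is a direct sum of cyclic $R$-modules. Let $\Lambda$ be an index set and let $x,y\in R$ and $w_\lambda\in R$ ($\lambda\in\Lambda$) be elements such that $\mathcal{M}=Rx\oplus Ry\oplus\left(\bigoplus_{\lambda\in\Lambda}Rw_\lambda\right)$ with each $Rw_\lambda$ a simple $R$-module. Then both $R/\mathrm{Ann}(x)$ and $R/\mathrm{Ann}(y)$ are principal ideal rings.
   Context: All rings are commutative with identity and all modules are unital. A ring is local if it has a unique maximal ideal (no Noetherian assumption); $(R,\mathcal{M})$ denotes a local ring with maximal ideal $\mathcal{M}$. For $a\in R$, $\mathrm{Ann}(a)=\{r\in R : ra=0\}$. A module is simple if it is nonzero and has no submodules except $(0)$ and itself. Direct sums of ideals contained in $R$ are internal. A principal ideal ring is a ring in which every ideal is principal (the zero ring is allowed). Index sets may be empty, and the elements $x,y$ may be zero. *)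

(* Defs.v *)
From HB Require Import structures.
From mathcomp Require Import all_boot all_algebra.
From mathcomp Require Import boolp classical_sets.

Set Implicit Arguments.
Unset Strict Implicit.
Unset Printing Implicit Defensive.

Import GRing.Theory.
Local Open Scope classical_set_scope.
Local Open Scope quotient_scope.
Local Open Scope ring_scope.

(* Rings are [comPzRingType]s, so that the zero ring is allowed (as in
   R / Ann(0)).  The ideals of [ring_quotient] are decidable and proper, so
   ideals are taken here as arbitrary sets, possibly improper. *)

Section Ideals.
Variable R : comPzRingType.
Implicit Types I M N : set R.

Definition is_ideal I : Prop :=
  [/\ I 0, forall a b, I a -> I b -> I (a + b) & forall r a, I a -> I (r * a)].

Definition principal (a : R) : set R := range (fun r => r * a).

Definition maximal_ideal M : Prop :=
  [/\ is_ideal M, M <> setT &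
      forall I, is_ideal I -> M `<=` I -> I = M \/ I = setT].

Definition local_ring M : Prop :=
  maximal_ideal M /\ forall N, maximal_ideal N -> N = M.

(* The R-submodules of an ideal N are exactly the ideals contained in N. *)
Definition simple_ideal N : Prop :=
  [/\ is_ideal N, N <> [set 0] &
      forall I, is_ideal I -> I `<=` N -> I = [set 0] \/ I = N].

(* I is the internal direct sum of the ideals F j: it is the set of all finite
   sums of elements of the F j, and such a sum over pairwise distinct indices
   vanishes only if all its terms do. *)
Definition internal_dsum (J : Type) (F : J -> set R) I : Prop :=
  (forall a, I a <-> exists n (j : 'I_n -> J) (c : 'I_n -> R),
      (forall i, F (j i) (c i)) /\ a = \sum_(i < n) c i) /\
  (forall n (j : 'I_n -> J) (c : 'I_n -> R), injective j ->
      (forall i, F (j i) (c i)) -> \sum_(i < n) c i = 0 -> forall i, c i = 0).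

Definition dsum_of_cyclics I : Prop :=
  exists (J : Type) (c : J -> R), internal_dsum (fun j => principal (c j)) I.

Definition dsum_family (L : Type) (A B : set R) (C : L -> set R) :
    option (option L) -> set R :=
  fun i => match i with
           | None => A
           | Some None => B
           | Some (Some l) => C l
           end.

End Ideals.

Definition principal_ideal_ring (R : comPzRingType) : Prop :=
  forall I : set R, is_ideal I -> exists a, I = principal a.

Section AnnQuotient.
Variables (R : comPzRingType) (a : R).

Definition Ann : {pred R} := [pred r | r * a == 0].

Lemma Ann_zmod_closed : zmod_closed Ann.
Proof.
split=> [|r s]; rewrite !inE ?mul0r //.
by move=> /eqP ra /eqP sa; rewrite mulrBl ra sa subrr.
Qed.

HB.instance Definition _ := GRing.isZmodClosed.Build R Ann Ann_zmod_closed.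

(* [{ideal_quot _}] carries a ring structure only for proper ideals; here
   Ann(a) = R when a = 0, so the ring structure is put on the quotient
   additive group. *)
Definition ann_quot : Type := {ideal_quot Ann}.

HB.instance Definition _ := GRing.Zmodule.on ann_quot.
HB.instance Definition _ := EqQuotient.on ann_quot.

Lemma ann_quot_eqP (r s : R) :
  reflect (\pi_ann_quot r = \pi_ann_quot s) (r - s \in Ann).
Proof. by rewrite [_ \in _]Quotient.idealrBE; apply: eqP. Qed.

Definition ann_one : ann_quot := \pi_ann_quot 1.
Definition ann_mul (u v : ann_quot) : ann_quot :=
  \pi_ann_quot (repr u * repr v).

Lemma ann_pi_mul (r s : R) :
  \pi_ann_quot (r * s) = ann_mul (\pi_ann_quot r) (\pi_ann_quot s).
Proof.
apply/ann_quot_eqP.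
set r' := repr _; set s' := repr _.
have /ann_quot_eqP hr : \pi_ann_quot r = \pi_ann_quot r' by rewrite reprK.
have /ann_quot_eqP hs : \pi_ann_quot s = \pi_ann_quot s' by rewrite reprK.
move: hr hs; rewrite !inE => /eqP hr /eqP hs; apply/eqP.
have -> : r * s - r' * s' = s * (r - r') + r' * (s - s').
  by rewrite !mulrBr [s * r]mulrC [s * r']mulrC addrA addrNK.
by rewrite mulrDl -!mulrA hr hs !mulr0 addr0.
Qed.

Lemma ann_pi0 : \pi_ann_quot 0 = 0.
Proof. exact: (@pi_zeror R _ _ _ _ {ideal_quot Ann}). Qed.

Lemma ann_pi_add (r s : R) :
  \pi_ann_quot (r + s) = \pi_ann_quot r + \pi_ann_quot s.
Proof. exact: (@Quotient.pi_add R Ann). Qed.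

Lemma ann_mulA : associative ann_mul.
Proof.
elim/quotW=> r; elim/quotW=> s; elim/quotW=> t.
by rewrite -(ann_pi_mul s t) -(ann_pi_mul r s) -!ann_pi_mul mulrA.
Qed.

Lemma ann_mulC : commutative ann_mul.
Proof.
by elim/quotW=> r; elim/quotW=> s; rewrite -(ann_pi_mul r s) mulrC ann_pi_mul.
Qed.

Lemma ann_mul1 : left_id ann_one ann_mul.
Proof. by elim/quotW=> r; rewrite -(ann_pi_mul 1 r) mul1r. Qed.

Lemma ann_mulDl : left_distributive ann_mul +%R.
Proof.
elim/quotW=> r; elim/quotW=> s; elim/quotW=> t.
rewrite -(ann_pi_add r s) -(ann_pi_mul (r + s) t) mulrDl ann_pi_add.
by rewrite !ann_pi_mul.
Qed.

HB.instance Definition _ := GRing.Zmodule_isComPzRing.Build ann_quot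
  ann_mulA ann_mulC ann_mul1 ann_mulDl.

End AnnQuotient.

(* Main.v *)
(** Write [M = Rx + Z] with [Z x = 0]: the ring [R / Ann(x)] is local with
    principal maximal ideal generated by the class of [x], so each [r x] is
    either [u x^(k+1)] with [u] a unit, or lies in [N], the intersection of the
    ideals [R x^(n+1)].  One checks [N = xN].  As [N] is a direct sum of cyclic
    ideals [R c_j], projecting gives [R c_j = x R c_j], so [c_j = 0] since
    [1 - t x] is a unit, and [N = 0].  Hence a nonzero ideal of [R / Ann(x)] is
    generated by the smallest power of [x] that it contains. *)

Require Import Defs.
From mathcomp Require Import all_boot all_algebra.
From mathcomp Require Import boolp classical_sets.

Set Implicit Arguments.
Unset Strict Implicit.
Unset Printing Implicit Defensive.

Import GRing.Theory.
Local Open Scope classical_set_scope.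
Local Open Scope quotient_scope.
Local Open Scope ring_scope.

(** * Units, maximal ideals and Nakayama's lemma in a local ring *)

Definition invertible (R : comPzRingType) (r : R) : Prop :=
  exists s, s * r = 1.

Section IdealFacts.
Variable R : comPzRingType.
Implicit Types (I M : set R) (r a x : R).

Lemma idealN I a : is_ideal I -> I a -> I (- a).
Proof. by case=> _ _ IM Ia; rewrite -mulN1r; apply: IM. Qed.

Lemma ideal_sum I (T : Type) (s : seq T) (P : pred T) (f : T -> R) :
  is_ideal I -> (forall i, P i -> I (f i)) -> I (\sum_(i <- s | P i) f i).
Proof. by case=> I0 ID _ If; apply: (big_ind I). Qed.

Lemma principal_is_ideal a : is_ideal (principal a).
Proof.
split; first by exists 0 => //; rewrite mul0r.
- by move=> _ _ [r _ <-] [s _ <-]; exists (r + s) => //; rewrite mulrDl.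
- by move=> r _ [s _ <-]; exists (r * s) => //; rewrite mulrA.
Qed.

(** Zorn's lemma: a maximal nonempty member of [P] below is an ideal, and a larger ideal avoiding
    [1] would again belong to [P]. *)
Lemma sub_maximal_ideal r :
  ~ invertible r -> exists2 M, maximal_ideal M & M r.
Proof.
move=> nr.
(* The empty set is admitted so that the empty chain is bounded. *)
pose P : set (set R) := [set A | [/\ ~ A 1,
  forall a b, A a -> A b -> A (a + b), forall s a, A a -> A (s * a) &
  forall a, A a -> A r]].
have [F FP Ftot|A [[A1 AD AM Ar] Amax]] := @Zorn_bigcup R P.
  split.
  - by move=> [X /FP[X1 _ _ _]].
  - move=> a b [X FX Xa] [Y FY Yb].
    have [XY|YX] := Ftot _ _ FX FY.
      by exists Y => //; have [_ YD _ _] := FP _ FY; apply: YD => //; apply: XY.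
    by exists X => //; have [_ XD _ _] := FP _ FX; apply: XD => //; apply: YX.
  - by move=> s a [X FX Xa]; exists X => //; have [_ _ XM _] := FP _ FX; apply: XM.
  - by move=> a [X FX Xa]; exists X => //; have [_ _ _ Xr] := FP _ FX; apply: Xr Xa.
(* An empty [A] is not maximal: [principal r] avoids [1], as [r] is no unit. *)
have [A0|A0] := pselect (exists a, A a); last first.
  have [|] := Amax (principal r).
    split; first by move=> a Aa; case: A0; exists a.
    by move=> /(_ r) H; apply: A0; exists r; apply: H; exists 1; rewrite ?mul1r.
  have [_ PD PM] := principal_is_ideal r.
  split=> //; first by move=> [s _ sr]; apply: nr; exists s.
  by move=> _ _; exists 1; rewrite ?mul1r.
case: A0 => a0 Aa0; exists A; last exact: Ar Aa0.
split.
- by split=> //; rewrite -(mul0r a0); apply: AM.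
- by move=> AT; apply: A1; rewrite AT.
move=> I [I0 ID IM] AI.
have [I1|I1] := pselect (I 1).
  by right; apply/seteqP; split=> // b _; rewrite -(mulr1 b); apply: IM.
left; apply/seteqP; split=> //; apply: contrapT => IA.
by apply: (Amax I) => //; split=> // _ _; apply: AI; apply: Ar Aa0.
Qed.

Lemma local_non_invertible M r : local_ring M -> ~ invertible r -> M r.
Proof. by move=> [_ Mu] /sub_maximal_ideal[N /Mu ->]. Qed.

Lemma maximal_ideal_not1 M : maximal_ideal M -> ~ M 1.
Proof.
move=> [[_ _ MM] MT _] M1; apply: MT; apply/seteqP; split=> // a _.
by rewrite -(mulr1 a); apply: MM.
Qed.

(** The factor [1 - t * x] kills [a] and is a unit: otherwise it lies in [M], and so does [1]. *)
Lemma local_nakayama M x t a :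
  local_ring M -> M x -> a = t * x * a -> a = 0.
Proof.
move=> Ml Mx ae; have [Mid _ _] := Ml.1; have [_ MD MM] := Mid.
have [[s s1]|/(local_non_invertible Ml) M1] := pselect (invertible (1 - t * x)).
  by rewrite -(mul1r a) -s1 -mulrA mulrBl mul1r -ae subrr mulr0.
case: (maximal_ideal_not1 Ml.1).
by rewrite -(subrK (t * x) 1); apply: MD => //; apply: MM.
Qed.

End IdealFacts.

(** * Components in an internal direct sum of ideals *)

Section DirectSums.
Variables (R : comPzRingType) (J : eqType) (F : J -> set R) (I : set R).
Hypothesis Fideal : forall j, is_ideal (F j).
Hypothesis FI : internal_dsum F I.

Lemma dsum_mem j a : F j a -> I a.
Proof.
move=> Fa; apply/FI.1; exists 1%N, (fun=> j), (fun=> a); split=> //.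
by rewrite big_ord1.
Qed.

Lemma dsum_seq_eq0 (s : seq J) (h : J -> R) :
  uniq s -> (forall k, F k (h k)) -> \sum_(k <- s) h k = 0 ->
  forall k, k \in s -> h k = 0.
Proof.
move=> us Fh h0 k /(tnthP (in_tuple s))[i ->].
apply: (FI.2 _ (tnth (in_tuple s)) (fun i => h (tnth (in_tuple s) i))) => //.
- exact/tuple_uniqP.
- by rewrite -(big_tnth _ _ s xpredT h).
Qed.

(** The product lies in both summands; independence is applied to [a * b] at [j] and [- (a * b)] at
    [k]. *)
Lemma dsum_mul_eq0 j k a b : j != k -> F j a -> F k b -> a * b = 0.
Proof.
move=> jk Fa Fb.
have [_ _ FjM] := Fideal j; have [_ _ FkM] := Fideal k.
pose h l := if l == j then a * b else if l == k then - (a * b) else 0.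
have := @dsum_seq_eq0 [:: j; k] h; rewrite /h /= inE jk /=.
move=> /(_ isT) H; have := H _ _ j; rewrite eqxx; apply.
- move=> l; case: eqP => [->|_]; first by rewrite mulrC; apply: FjM.
  case: eqP => [->|_]; first by apply: idealN => //; apply: FkM.
  by have [] := Fideal l.
- by rewrite !big_cons big_nil eqxx eq_sym (negbTE jk) eqxx addr0 subrr.
- by rewrite inE eqxx.
Qed.

Lemma sum_uniq_pick (s : seq J) j a :
  uniq s -> j \in s -> \sum_(k <- s | k == j) a = a :> R.
Proof.
move=> us js; rewrite big_mkcond (bigD1_seq j) //= eqxx big1 ?addr0 //.
by move=> k /negbTE ->.
Qed.

(** The witness is the component of [d] in [F j]: compare the components at [j] on both sides of
    [a = x * d]. *)
Lemma dsum_component j a d x :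
  F j a -> I d -> a = x * d -> exists2 e, F j e & a = x * e.
Proof.
move=> Fa /FI.1[n [f [c [Fc ->]]]] ae.
(* The indices [f i] may repeat, so the terms of equal index are collected. *)
pose g k := \sum_(i < n | k == f i) c i.
have Fg k : F k (g k) by apply: ideal_sum => // i /eqP ->.
exists (g j) => //.
(* The index [j] is added since it need not occur among the [f i]. *)
pose s := undup (j :: [seq f i | i <- enum 'I_n]).
have us : uniq s by apply: undup_uniq.
have js : j \in s by rewrite mem_undup mem_head.
have gs : \sum_(k <- s) g k = \sum_(i < n) c i.
  rewrite /g (exchange_big_dep xpredT) //=; apply: eq_bigr => i _.
  by rewrite sum_uniq_pick // mem_undup in_cons map_f ?mem_enum ?orbT.
pose h k := x * g k - (if k == j then a else 0).
suff : h j = 0 by rewrite /h eqxx => /eqP; rewrite subr_eq0 => /eqP.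
apply: (@dsum_seq_eq0 s) => //.
  move=> k; have [k0 kD kM] := Fideal k.
  apply: kD; first exact: kM.
  by apply: idealN => //; case: eqP => [->|].
by rewrite sumrB -mulr_sumr gs -ae -big_mkcond sum_uniq_pick // subrr.
Qed.

End DirectSums.

(** * Powers of [x] and the ideals of the quotient by [Ann x] *)

Section PrincipalModuloAnnihilator.
Variables (R : comPzRingType) (M : set R) (x : R).
Hypothesis Mloc : local_ring M.
Hypothesis cyc : forall I : set R, is_ideal I -> dsum_of_cyclics I.
Hypothesis Mx : M x.
Hypothesis Mmulx : forall s, M s -> exists t, s * x = t * x ^+ 2.

Let N : set R := [set a | forall n, exists r, a = r * x ^+ n.+1].

Let N_is_ideal : is_ideal N.
Proof.
split=> [n|a b Na Nb n|r a Na n].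
- by exists 0; rewrite mul0r.
- by have [[r ->] [s ->]] := (Na n, Nb n); exists (r + s); rewrite mulrDl.
- by have [s ->] := Na n; exists (r * s); rewrite mulrA.
Qed.

(** If [r * x = s * x ^+ n.+1] and [s] is not a unit, then [s] is in [M], so [Mmulx] raises the
    exponent by one. *)
Let mulx_unit_power r : N (r * x) \/
  exists k u, invertible u /\ r * x = u * x ^+ k.+1.
Proof.
have [[k [u H]]|H] :=
  pselect (exists k u, invertible u /\ r * x = u * x ^+ k.+1).
  by right; exists k, u.
left=> n; elim: n => [|n [s sE]]; first by exists r; rewrite expr1.
have Ms : M s.
  by apply: (local_non_invertible Mloc) => us; apply: H; exists n, s.
have [t tE] := Mmulx Ms.
by exists t; rewrite sE exprS mulrA tE -mulrA -exprD.
Qed.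

Let N_mulx c : N c -> exists2 d, N d & c = x * d.
Proof.
move=> Nc; have [r cE] := Nc 1%N.
have {}cE : c = x * (r * x) by rewrite cE expr2 mulrA mulrC.
have [Nrx|[k [u [[v vu] rE]]]] := mulx_unit_power r; first by exists (r * x).
(* Here [c = u * x ^+ k.+2], while membership in [N] gives [c = t * x ^+ k.+3]; Nakayama then forces
   [x ^+ k.+2 = 0], hence [c = 0]. *)
have [t tE] := Nc k.+2.
have {}tE : u * x ^+ k.+2 = t * x * x ^+ k.+2.
  by rewrite -mulrA -exprS -tE cE rE (mulrCA x) -exprS.
have xk0 : x ^+ k.+2 = 0.
  apply: (@local_nakayama _ _ x (v * t) _ Mloc Mx).
  by rewrite -!mulrA (mulrA t) -tE mulrA vu mul1r.
exists 0; first by have [] := N_is_ideal.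
by rewrite mulr0 cE rE (mulrCA x) -exprS xk0 mulr0.
Qed.

Let N_eq0 a : N a -> a = 0.
Proof.
have [J0 [c0 NE0]] := cyc N_is_ideal.
(* Classical equality makes the arbitrary index type an [eqType]. *)
pose J : eqType := {classic J0}.
have [c NE] : exists c : J -> R, internal_dsum (fun j => principal (c j)) N.
  by exists c0.
have Fid j : is_ideal (principal (c j)) by apply: principal_is_ideal.
have cj0 j : c j = 0.
  have Fc : principal (c j) (c j) by exists 1; rewrite ?mul1r.
  have [d Nd cE] := N_mulx (dsum_mem NE Fc).
  have [_ [r _ <-] {}cE] := dsum_component Fid NE Fc Nd cE.
  apply: (@local_nakayama _ _ x r _ Mloc Mx).
  by rewrite {1}cE mulrA (mulrC x).
move=> /NE.1[n [f [e [Fe ->]]]]; apply: big1 => i _.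
by have [r _ <-] := Fe i; rewrite cj0 mulr0.
Qed.

Local Notation proj r := (\pi_(ann_quot x) r : ann_quot x).

(** Modulo [Ann x] one factor [x] can be cancelled from [mulx_unit_power]. *)
Let proj_unit_power r :
  proj r = 0 \/ exists k u, invertible u /\ proj r = proj (u * x ^+ k).
Proof.
have projE s t : s * x = t * x -> proj s = proj t.
  by move=> st; apply/ann_quot_eqP; rewrite inE mulrBl st subrr.
have [/N_eq0 rx0|[k [u [uu rE]]]] := mulx_unit_power r.
  by left; rewrite -ann_pi0; apply: projE; rewrite rx0 mul0r.
by right; exists k, u; split=> //; apply: projE; rewrite rE -mulrA -exprSr.
Qed.

Lemma ann_quot_principal : principal_ideal_ring (ann_quot x).
Proof.
have projM r s : proj (r * s) = proj r * proj s := ann_pi_mul x r s.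
move=> I [I0 _ IM].
(* Multiplying by the inverse of [u] puts the bare power of [x] in [I]. *)
have Ipow v : I v ->
    v = 0 \/ exists k u, I (proj (x ^+ k)) /\ v = proj (u * x ^+ k).
  elim/quotW: v => r Ir.
  have [->|[k [u [[s su] rE]]]] := proj_unit_power r; first by left.
  right; exists k, u; split=> //.
  by rewrite -(mul1r (x ^+ k)) -su -mulrA projM -rE; apply: IM.
(* If [I] contains no power of [x], it is zero; otherwise the least such power generates it. *)
have [ex_k|Ik] := pselect (exists k, `[< I (proj (x ^+ k)) >]); last first.
  exists 0; apply/seteqP; split=> [v /Ipow[->|[k [_ [Ixk _]]]]|_ [r _ <-]].
  - by exists 0; rewrite ?mul0r.
  - by case: Ik; exists k; apply/asboolP.
  - by rewrite mulr0.
case: (ex_minnP ex_k) => k /asboolP Ixk kmin.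
exists (proj (x ^+ k)); apply/seteqP; split=> [v|_ [r _ <-]]; last exact: IM.
move=> /Ipow[->|[j [u [/asboolP/kmin kj ->]]]]; first by exists 0; rewrite ?mul0r.
by exists (proj (u * x ^+ (j - k))); rewrite // -projM -mulrA -exprD subnK.
Qed.

End PrincipalModuloAnnihilator.

(** Terms of [s] outside [F j] annihilate [x]; a term [r * x] in [F j] contributes [r * x ^+ 2]. *)
Lemma dsum_mulr_square (R : comPzRingType) (J : eqType) (F : J -> set R)
    (I : set R) (j : J) (x s : R) :
  (forall k, is_ideal (F k)) -> internal_dsum F I -> F j = principal x ->
  I s -> exists t, s * x = t * x ^+ 2.
Proof.
move=> Fid FI Fj /FI.1[n [f [c [Fc ->]]]].
suff H i : principal (x ^+ 2) (c i * x).
  have [] : principal (x ^+ 2) ((\sum_(i < n) c i) * x).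
    by rewrite mulr_suml; apply: ideal_sum => //; apply: principal_is_ideal.
  by move=> t _ tE; exists t.
have [fj|fj] := eqVneq (f i) j.
  by have := Fc i; rewrite fj Fj => -[r _ <-]; exists r; rewrite // expr2 mulrA.
have Fx : F j x by rewrite Fj; exists 1; rewrite ?mul1r.
by rewrite (dsum_mul_eq0 Fid FI fj (Fc i) Fx); exists 0; rewrite ?mul0r.
Qed.

Theorem theorem3p3 (R : comPzRingType) (M : set R) (hloc : local_ring M)
    (hcyc : forall I : set R, is_ideal I -> dsum_of_cyclics I)
    (L : Type) (x y : R) (w : L -> R)
    (hM : internal_dsum
            (dsum_family (principal x) (principal y)
                         (fun l => principal (w l))) M)
    (hw : forall l, simple_ideal (principal (w l))) :
  principal_ideal_ring (ann_quot x) /\ principal_ideal_ring (ann_quot y).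
Proof.
pose J : eqType := {classic option (option L)}.
pose F : J -> set R :=
  dsum_family (principal x) (principal y) (fun l => principal (w l)).
have Fid k : is_ideal (F k) by case: k => [[l|]|]; apply: principal_is_ideal.
have FM : internal_dsum F M by [].
(* One argument serves both generators: [x] has index [None] and [y] has index [Some None]. *)
have H (j : J) z : F j = principal z -> principal_ideal_ring (ann_quot z).
  move=> Fj; apply: (ann_quot_principal hloc hcyc).
    by apply: (dsum_mem FM (j := j)); rewrite Fj; exists 1; rewrite ?mul1r.
  by move=> s; apply: dsum_mulr_square Fid FM Fj.
by split; [apply: (H None) | apply: (H (Some None))].
Qed.
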